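(* Let $V_I, V_O:\mathbb{R}\to\mathbb{C}$ and $r\in\mathbb{C}$. Put $a_0 = 3906249999.75586$, $a_1 = 62500.0000039063$, $b_0 = 7812500000.48828$ (exact decimal real numbers). Assume: (A1) $V_I$ is differentiable at every $t\in\mathbb{R}$ (the order-$0$ higher-derivative differentiability condition for $V_I$ holds at every $t$); (A2) $V_O$, $V_O'$ and $V_O''$ are differentiable at every $t\in\mathbb{R}$ (the order-$2$ higher-derivative differentiability condition for $V_O$ holds at every $t$); (A3) $V_O(0)=0$ and $V_O'(0)=0$; (A4) for all $s\in\mathbb{C}$ with $\operatorname{Re} r\le \operatorname{Re} s$, $s^2 + a_1 s + a_0\neq 0$; (A5) for all $s$ with $\operatorname{Re} r\le\operatorname{Re} s$, $\mathcal{L}[V_I](s)\neq 0$; (A6) $0<\operatorname{Re} r$; (A7) for all $s$ with $\operatorname{Re} r\le\operatorname{Re} s$, the Laplace transform of $V_I$ exists at $s$; (A8) for all $s$ with $\operatorname{Re} r\le\operatorname{Re} s$, the Laplace transforms of $V_O$, $V_O'$, $V_O''$ exist at $s$; (A9) for all $s$ with $\operatorname{Re} r\le\operatorname{Re} s$, $\dfrac{\mathcal{L}[V_O](s)}{\mathcal{L}[V_I](s)} = \dfrac{b_0}{s^2 + a_1 s + a_0}$. Then for all $t\ge 0$, $a_0 V_O(t) + a_1 V_O'(t) + V_O''(t) = b_0 V_I(t)$.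
   Context: All functions are complex-valued functions of a real variable $t$; derivatives are with respect to $t$. The Laplace transform is $\mathcal{L}[f](s)=\int_{\{t\,:\,0\le t\}} e^{-st} f(t)\,dt$ for $s\in\mathbb{C}$. ''The Laplace transform of $f$ exists at $s$'' means: $f$ is piecewise differentiable on $[0,b]$ for every $b$, and there exist $M>0$ and a real $a$ with $\operatorname{Re}s>a$ such that $|f(t)|\le M e^{a t}$ for all $t\ge 0$. The conclusion is the order-$2$ linear differential equation with output coefficient list $(a_0,a_1,1)$ and input coefficient list $(b_0)$, modelling a Sallen-key low-pass filter. *)

(* Defs.v *)
From Stdlib Require Import Reals List.
From Coquelicot Require Export Coquelicot.
Open Scope R_scope.

Definition Cexp (z : C) : C :=
  (exp (Re z) * cos (Im z), exp (Re z) * sin (Im z)).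

Definition Cdifferentiable (f : R -> C) (t : R) : Prop :=
  ex_derive (K := R_AbsRing) (V := C_R_NormedModule) f t.

(* Coquelicot's [Derive] is restricted to real-valued functions. *)
Definition Cderive (f : R -> C) (t : R) : C :=
  (Derive (fun u => Re (f u)) t, Derive (fun u => Im (f u)) t).

Lemma Cderive_correct (f : R -> C) (t : R) :
  Cdifferentiable f t ->
  is_derive (K := R_AbsRing) (V := C_R_NormedModule) f t (Cderive f t).
Proof.
intros [l Hl].
replace (Cderive f t) with l; [exact Hl|].
assert (H1 : is_derive (fun u => Re (f u)) t (fst l)).
{ apply (filterdiff_comp' (V := C_R_NormedModule) (W := R_NormedModule)
           f (@fst R R) t _ (@fst R R) Hl).
  apply filterdiff_linear.
  exact (is_linear_fst (U := R_NormedModule) (V := R_NormedModule)). }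
assert (H2 : is_derive (fun u => Im (f u)) t (snd l)).
{ apply (filterdiff_comp' (V := C_R_NormedModule) (W := R_NormedModule)
           f (@snd R R) t _ (@snd R R) Hl).
  apply filterdiff_linear.
  exact (is_linear_snd (U := R_NormedModule) (V := R_NormedModule)). }
apply is_derive_unique in H1, H2.
rewrite (surjective_pairing l).
exact (eq_sym (f_equal2 pair H1 H2)).
Qed.

(* The integral over {t | 0 <= t}, taken as an improper Riemann integral of
   C-valued functions; like every [RInt_gen] it is a junk value when the
   integral does not converge. *)
Definition laplace (f : R -> C) (s : C) : C :=
  RInt_gen (V := C_R_CompleteNormedModule)
    (fun t : R => (Cexp (- s * t) * f t)%C)
    (at_point 0) (Rbar_locally p_infty).

(* Continuity at the end points is relative to the interval, while
   differentiability is two-sided, off a finite set of exceptional points. *)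
Definition piecewise_differentiable_on (f : R -> C) (a b : R) : Prop :=
  continuous_on (T := R_UniformSpace) (U := C_UniformSpace)
    (fun t => a <= t <= b) f /\
  exists exc : list R,
    forall t, a <= t <= b -> ~ In t exc -> Cdifferentiable f t.

Definition exp_order (f : R -> C) (M a : R) : Prop :=
  0 < M /\ forall t, 0 <= t -> Cmod (f t) <= M * exp (a * t).

Definition laplace_exists (f : R -> C) (s : C) : Prop :=
  (forall b, piecewise_differentiable_on f 0 b) /\
  exists M a : R, a < Re s /\ exp_order f M a.

Definition sk_a0 : R := 3906249999.75586.
Definition sk_a1 : R := 62500.0000039063.
Definition sk_b0 : R := 7812500000.48828.

(* Main.v *)
(** Only real [s] are needed, so real and imaginary parts separate. With
    [G = a0 VO + a1 VO' + VO''] and [P(s) = s^2 + a1 s + a0],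
    [exp(-st) (G - P(s) VO)] is the derivative of [exp(-st) (VO' + (s + a1) VO)],
    which vanishes at [0] and at infinity; hence [g = G - b0 VI] has zero Laplace
    transform at every real [s >= Re r].

    Such a continuous [g] vanishes on [[0, +oo)] (Lerch): [h(t) = exp(-rt) g(t)]
    is orthogonal to every [exp(-nt)], hence to all powers of the Landau kernel
    [1 - (exp(-t) - exp(-t0))^2], which lies in [[0, 1]] and is maximal exactly
    at [t0]. If [h t0 > 0], the mass of the [m]-th power near [t0] beats the rest
    for large [m], and the integral cannot be zero. *)

Require Import Defs.
From Stdlib Require Import Reals Lra Psatz.
From Coquelicot Require Import Coquelicot.
Open Scope R_scope.

(** * Integrals of exponentially decaying functions *)

Lemma is_RInt_exp_decay (d u v : R) : 0 < d ->
  is_RInt (fun t => exp (- (d * t))) u v ((exp (- (d * u)) - exp (- (d * v))) / d).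
Proof.
intros Hd.
replace ((exp (- (d * u)) - exp (- (d * v))) / d)
  with (minus (- exp (- (d * v)) / d) (- exp (- (d * u)) / d))
  by (unfold minus, plus, opp; simpl; field; lra).
apply (is_RInt_derive (fun t => - exp (- (d * t)) / d) (fun t => exp (- (d * t)))).
- intros x _. auto_derive; [trivial|]. field. lra.
- intros x _. apply (ex_derive_continuous (fun t => exp (- (d * t)))). auto_derive. trivial.
Qed.

Lemma is_lim_exp_decay (d : R) : 0 < d ->
  is_lim (fun t => exp (- (d * t))) p_infty 0.
Proof.
intros Hd.
apply (is_lim_comp exp (fun t => - (d * t)) p_infty 0 m_infty).
- apply is_lim_exp_m.
- apply (is_lim_ext (fun t => (- d) * t)); [intros; ring|].
  evar_last; [apply is_lim_scal_l, is_lim_id|].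
  simpl. destruct (Rle_dec 0 (- d)); [exfalso; lra|reflexivity].
- exists 0. intros; discriminate.
Qed.

Lemma ex_RInt_continuous_R (f : R -> R) (a b : R) :
  (forall t, continuous f t) -> ex_RInt f a b.
Proof. intros Hf. apply (@ex_RInt_continuous R_CompleteNormedModule). intros; apply Hf. Qed.

Lemma abs_RInt_exp_bound (h : R -> R) (M d u v : R) : 0 < d -> 0 <= u <= v ->
  (forall t, continuous h t) ->
  (forall t, 0 <= t -> Rabs (h t) <= M * exp (- (d * t))) ->
  Rabs (RInt h u v) <= M * ((exp (- (d * u)) - exp (- (d * v))) / d).
Proof.
intros Hd [Hu Huv] Hc Hb.
apply (norm_RInt_le (V := R_NormedModule) h (fun t => M * exp (- (d * t))) u v); auto.
- intros x Hx. apply Hb. lra.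
- apply (RInt_correct (V := R_CompleteNormedModule)). apply ex_RInt_continuous_R; auto.
- apply (is_RInt_scal (V := R_NormedModule) (fun t => exp (- (d * t)))).
  apply is_RInt_exp_decay; auto.
Qed.

(** Cauchy criterion at infinity: the piece of the integral over [[u, v]] is at most
    [M * exp (- (d * u)) / d], which is small as soon as [u] is large. *)
Lemma RInt_exp_bound_converges (h : R -> R) (M d : R) : 0 < d ->
  (forall t, continuous h t) ->
  (forall t, 0 <= t -> Rabs (h t) <= M * exp (- (d * t))) ->
  exists l : R, is_lim (fun b => RInt h 0 b) p_infty l.
Proof.
intros Hd Hc Hb.
assert (HM : 0 <= M).
{ specialize (Hb 0 (Rle_refl 0)). rewrite Rmult_0_r, Ropp_0, exp_0 in Hb.
  pose proof (Rabs_pos (h 0)). lra. }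
apply (proj1 (filterlim_locally_cauchy (U := R_CompleteNormedModule) (F := Rbar_locally p_infty)
   (fun b => RInt h 0 b))).
intros eps.
(* Threshold for [exp (- (d * u))] that brings the tail below [eps]; [M + 1] keeps the division
   meaningful when [M = 0]. *)
assert (Heps : 0 < eps * d / (M + 1)).
{ pose proof (cond_pos eps). apply Rdiv_lt_0_compat; nra. }
destruct (proj2 (is_lim_spec _ _ _) (is_lim_exp_decay d Hd) (mkposreal _ Heps)) as [B HB].
exists (fun t => Rmax B 0 < t). split; [exists (Rmax B 0); auto|].
assert (key : forall u v, Rmax B 0 < u -> u <= v -> Rabs (RInt h 0 v - RInt h 0 u) < eps).
{ intros u v Hu Huv.
  pose proof (Rmax_l B 0). pose proof (Rmax_r B 0).
  replace (RInt h 0 v - RInt h 0 u) with (RInt h u v).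
  2:{ rewrite <- (RInt_Chasles h 0 u v) by (apply ex_RInt_continuous_R; auto).
      exact (eq_sym (Rplus_minus_l (RInt h 0 u) (RInt h u v))). }
  eapply Rle_lt_trans; [apply abs_RInt_exp_bound with (M := M) (d := d); auto; lra|].
  assert (Hu' := HB u ltac:(lra)). simpl in Hu'.
  rewrite Rminus_0_r in Hu'. rewrite Rabs_pos_eq in Hu' by (left; apply exp_pos).
  pose proof (exp_pos (- (d * v))). pose proof (exp_pos (- (d * u))).
  apply Rle_lt_trans with (M * (exp (- (d * u)) / d)).
  - apply Rmult_le_compat_l; auto. apply Rmult_le_compat_r; [left; apply Rinv_0_lt_compat|]; lra.
  - apply Rle_lt_trans with ((M + 1) * (exp (- (d * u)) / d)).
    + apply Rmult_le_compat_r; [|lra]. apply Rlt_le, Rdiv_lt_0_compat; lra.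
    + replace (pos eps) with ((M + 1) * ((eps * d / (M + 1)) / d)) by (field; lra).
      apply Rmult_lt_compat_l; [lra|]. apply Rmult_lt_compat_r; auto.
      apply Rinv_0_lt_compat; lra. }
intros u v Hu Hv.
change (Rabs (RInt h 0 v - RInt h 0 u) < eps).
destruct (Rle_dec u v) as [H|H].
- auto.
- rewrite Rabs_minus_sym. apply key; auto; lra.
Qed.

(** * Lerch's uniqueness theorem through the Landau kernel *)

Definition landau (t0 t : R) : R := 1 - (exp (- t) - exp (- t0)) ^ 2.

Lemma continuous_exp_scal (s t : R) : continuous (fun t => exp (- (s * t))) t.
Proof. apply (ex_derive_continuous (fun t => exp (- (s * t)))). auto_derive. trivial. Qed.

Lemma continuous_landau_pow (t0 : R) (m : nat) (t : R) :
  continuous (fun t => landau t0 t ^ m) t.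
Proof.
apply (ex_derive_continuous (fun t => landau t0 t ^ m)). unfold landau. auto_derive. trivial.
Qed.

(** With [x = exp (- t0)] the kernel expands to [(1 - x^2) + 2 x exp(-t) - exp(-2t)], so one more
    factor of it turns the integral for [n] into a combination of those for [n], [n + 1] and
    [n + 2]. Hence the induction on [m] carries all [n] at once. *)
Lemma landau_pow_integral_0 (h : R -> R) (t0 : R) :
  (forall t, continuous h t) ->
  (forall n : nat,
     is_lim (fun b => RInt (fun t => exp (- (INR n * t)) * h t) 0 b) p_infty 0) ->
  forall m n : nat,
    is_lim (fun b => RInt (fun t => exp (- (INR n * t)) * landau t0 t ^ m * h t) 0 b)
      p_infty 0.
Proof.
intros Hc H0 m. induction m as [|m IH]; intros n.
- eapply is_lim_ext; [|apply (H0 n)]. intros b. simpl. apply RInt_ext. intros; simpl; ring.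
- set (F := fun k t => exp (- (INR k * t)) * landau t0 t ^ m * h t).
  assert (HF : forall k b, ex_RInt (F k) 0 b).
  { intros k b. apply ex_RInt_continuous_R. intros t. unfold F.
    apply (continuous_mult (K := R_AbsRing)); [|apply Hc].
    apply (continuous_mult (K := R_AbsRing)); auto using continuous_exp_scal, continuous_landau_pow. }
  set (x := exp (- t0)).
  apply is_lim_ext with
    (fun b => (1 - x ^ 2) * RInt (F n) 0 b + 2 * x * RInt (F (n + 1)%nat) 0 b
              + (-1) * RInt (F (n + 2)%nat) 0 b).
  + intros b. symmetry.
    apply (is_RInt_unique (V := R_CompleteNormedModule)).
    apply (is_RInt_ext (V := R_NormedModule)
      (fun t => plus (plus (scal (1 - x ^ 2) (F n t)) (scal (2 * x) (F (n + 1)%nat t)))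
                     (scal (-1) (F (n + 2)%nat t)))).
    { intros t _. unfold F, plus, scal; simpl; unfold mult; simpl.
      rewrite !plus_INR.
      replace (- ((INR n + INR 1) * t)) with (- (INR n * t) + - t) by (simpl; ring).
      replace (- ((INR n + INR 2) * t)) with (- (INR n * t) + - t + - t) by (simpl; ring).
      (* The fourth occurrence is the single factor split off the power [S m]; the powers with
         exponent [m] stay opaque to [ring]. *)
      rewrite !exp_plus. unfold landau at 4. fold x. ring. }
    apply (is_RInt_plus (V := R_NormedModule)); [apply (is_RInt_plus (V := R_NormedModule))|];
      apply (is_RInt_scal (V := R_NormedModule)),
        (RInt_correct (V := R_CompleteNormedModule)), HF.
  + assert (Hs : forall c k, is_lim (fun b => c * RInt (F k) 0 b) p_infty 0).
    { intros c k. replace (Finite 0) with (Rbar_mult c 0) by (simpl; f_equal; ring).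
      apply is_lim_scal_l, IH. }
    replace (Finite 0) with (Finite (0 + 0 + 0)) by (f_equal; ring).
    apply is_lim_plus'; [apply is_lim_plus'|]; apply Hs.
Qed.

(** Strict monotonicity of [exp (- t)]: outside the [del]-neighbourhood of [t0] its value differs
    from [exp (- t0)] by at least the smaller of the gaps [e1], [e2] at the two end points. *)
Lemma exp_opp_separation (t0 del : R) : 0 < del ->
  exists eta, 0 < eta < 1 /\
    forall t, Rabs (exp (- t) - exp (- t0)) < eta -> Rabs (t - t0) < del.
Proof.
intros Hd.
set (e1 := exp (- t0) - exp (- (t0 + del))).
set (e2 := exp (- (t0 - del)) - exp (- t0)).
assert (H1 : 0 < e1) by (unfold e1; pose proof (exp_increasing (- (t0 + del)) (- t0)); lra).
assert (H2 : 0 < e2) by (unfold e2; pose proof (exp_increasing (- t0) (- (t0 - del))); lra).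
(* The cap [1 / 2] gives [eta < 1], so that [1 - eta ^ 2] will be a positive bound for the
   kernel. *)
exists (Rmin (1 / 2) (Rmin e1 e2)).
split.
- split; [repeat apply Rmin_pos; lra|].
  eapply Rle_lt_trans; [apply Rmin_l|lra].
- intros t Ht.
  assert (Ha : Rabs (exp (- t) - exp (- t0)) < e1).
  { eapply Rlt_le_trans; [exact Ht|]. eapply Rle_trans; [apply Rmin_r|apply Rmin_l]. }
  assert (Hb : Rabs (exp (- t) - exp (- t0)) < e2).
  { eapply Rlt_le_trans; [exact Ht|]. eapply Rle_trans; [apply Rmin_r|apply Rmin_r]. }
  apply Rabs_def2 in Ha, Hb. unfold e1, e2 in *.
  apply Rabs_def1.
  + assert (- (t0 + del) < - t) by (apply exp_lt_inv; lra). lra.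
  + assert (- t < - (t0 - del)) by (apply exp_lt_inv; lra). lra.
Qed.

Lemma exp_moments_0_nonpos (h : R -> R) (M d : R) : 0 < d ->
  (forall t, continuous h t) ->
  (forall t, 0 <= t -> Rabs (h t) <= M * exp (- (d * t))) ->
  (forall n : nat,
     is_lim (fun b => RInt (fun t => exp (- (INR n * t)) * h t) 0 b) p_infty 0) ->
  forall t0, 0 <= t0 -> h t0 <= 0.
Proof.
intros Hd Hc Hb Hm t0 Ht0.
destruct (Rle_lt_dec (h t0) 0) as [|Hpos]; [assumption|exfalso].
assert (HM : 0 <= M).
{ specialize (Hb 0 (Rle_refl 0)). rewrite Rmult_0_r, Ropp_0, exp_0 in Hb.
  pose proof (Rabs_pos (h 0)). lra. }
set (eps := h t0 / 2). assert (Heps : 0 < eps) by (unfold eps; lra).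
assert (Hnear : exists del, 0 < del /\ forall t, Rabs (t - t0) < del -> eps <= h t).
{ destruct (proj1 (filterlim_locally _ _) (Hc t0) (mkposreal _ Heps)) as [del Hdel].
  exists del. split; [apply cond_pos|]. intros t Ht.
  specialize (Hdel t Ht). change (Rabs (h t - h t0) < eps) in Hdel.
  apply Rabs_def2 in Hdel. unfold eps in *. lra. }
destruct Hnear as [del [Hdel Hnear]].
destruct (exp_opp_separation t0 del Hdel) as [eta [Heta Hsep]].
(* The interval lies to the right of [t0], so it stays in the domain of integration even for
   [t0 = 0]. The bound [eta / 2] in place of [eta] creates the gap between [p] and [q]. *)
assert (Hpeak : exists t1, t0 < t1 /\ forall t, t0 <= t <= t1 ->
   Rabs (exp (- t) - exp (- t0)) < eta / 2).
{ assert (Hc' : continuous (fun t => exp (- t)) t0)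
    by (apply (ex_derive_continuous (fun t => exp (- t))); auto_derive; trivial).
  assert (He2 : 0 < eta / 2) by lra.
  destruct (proj1 (filterlim_locally _ _) Hc' (mkposreal _ He2)) as [de Hde].
  exists (t0 + de / 2). pose proof (cond_pos de). split; [lra|]. intros t Ht.
  apply (Hde t). change (Rabs (t - t0) < de). apply Rabs_def1; lra. }
destruct Hpeak as [t1 [Ht1 Hpeak]].
(* The kernel is at most [q] where [h] may drop below [eps], and at least [p > q] on [[t0, t1]]. *)
set (q := 1 - eta ^ 2). set (p := 1 - (eta / 2) ^ 2).
assert (Hq : 0 < q) by (unfold q; nra).
assert (Hqp : q < p) by (unfold p, q; nra).
(* Both exponentials lie in [(0, 1]] for nonnegative arguments, so their difference has square below
   1. *)
assert (Hrange : forall t, 0 <= t -> 0 <= landau t0 t).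
{ intros t Ht. unfold landau.
  assert (Hx : forall u, 0 <= u -> 0 < exp (- u) <= 1).
  { intros u Hu. split; [apply exp_pos|]. rewrite <- exp_0.
    destruct Hu as [Hu|<-]; [left; apply exp_increasing; lra|right; f_equal; ring]. }
  pose proof (Hx t Ht). pose proof (Hx t0 Ht0). nra. }
set (f := fun (m : nat) t => landau t0 t ^ m * h t).
assert (Hfc : forall m t, continuous (f m) t).
{ intros m t. apply (continuous_mult (K := R_AbsRing)); auto using continuous_landau_pow. }
(* Two cases: where the exponentials are within [eta], [h] is positive and so is the lower bound's
   margin; elsewhere the kernel is at most [q] and the decay bound on [h] applies. *)
assert (Hflow : forall m t, 0 <= t -> - (q ^ m * M) * exp (- (d * t)) <= f m t).
{ intros m t Ht. unfold f.
  assert (Hl := pow_le _ m (Hrange t Ht)).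
  assert (Hqm := pow_le q m (Rlt_le _ _ Hq)).
  pose proof (exp_pos (- (d * t))).
  destruct (Rlt_le_dec (Rabs (exp (- t) - exp (- t0))) eta) as [H1|H1].
  - pose proof (Hnear t (Hsep t H1)).
    apply Rle_trans with 0; [|apply Rmult_le_pos; lra].
    assert (0 <= q ^ m * M * exp (- (d * t))) by (repeat apply Rmult_le_pos; lra). lra.
  - assert (Hlq : landau t0 t <= q).
    { unfold landau, q. rewrite <- (pow2_abs (exp (- t) - exp (- t0))).
      assert (eta ^ 2 <= Rabs (exp (- t) - exp (- t0)) ^ 2) by (apply pow_incr; lra). lra. }
    assert (Hlqm : landau t0 t ^ m <= q ^ m) by (apply pow_incr; split; auto).
    pose proof (Hb t Ht) as Hbt. pose proof (Rle_abs (- h t)) as Ha. rewrite Rabs_Ropp in Ha.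
    assert (landau t0 t ^ m * (- h t) <= q ^ m * (M * exp (- (d * t)))); [|lra].
    apply Rle_trans with (landau t0 t ^ m * (M * exp (- (d * t)))).
    + apply Rmult_le_compat_l; lra.
    + apply Rmult_le_compat_r; auto. apply Rmult_le_pos; lra. }
assert (Hfhigh : forall m t, t0 <= t <= t1 -> p ^ m * eps <= f m t).
{ intros m t Ht. unfold f. assert (H1 := Hpeak t Ht).
  assert (Hlp : p <= landau t0 t).
  { unfold landau, p. rewrite <- (pow2_abs (exp (- t) - exp (- t0))).
    assert (Rabs (exp (- t) - exp (- t0)) ^ 2 <= (eta / 2) ^ 2)
      by (apply pow_incr; split; [apply Rabs_pos|lra]). lra. }
  apply Rmult_le_compat; [apply pow_le; lra|lra|apply pow_incr; lra|].
  apply Hnear, Hsep. lra. }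
(* Split at [t0] and [t1]: the middle piece contributes at least [p ^ m * eps * (t1 - t0)], and each
   outer piece is at least [- (q ^ m * M / d)], because [exp (- (d * t))] has integral at most
   [1 / d] there. *)
assert (Hint : forall m b, t1 <= b ->
   p ^ m * eps * (t1 - t0) - 2 * (q ^ m * M / d) <= RInt (f m) 0 b).
{ intros m b Hbb.
  assert (Hex : forall u v, ex_RInt (f m) u v) by (intros; apply ex_RInt_continuous_R; auto).
  assert (Hqm := pow_le q m (Rlt_le _ _ Hq)).
  assert (Htail : forall u v, 0 <= u <= v -> - (q ^ m * M / d) <= RInt (f m) u v).
  { intros u v Huv.
    assert (HI := is_RInt_scal (V := R_NormedModule) _ _ _ (- (q ^ m * M)) _ (is_RInt_exp_decay d u v Hd)).
    apply Rle_trans with (scal (- (q ^ m * M)) ((exp (- (d * u)) - exp (- (d * v))) / d)).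
    - unfold scal; simpl; unfold mult; simpl.
      assert (exp (- (d * u)) <= 1).
      { rewrite <- exp_0. destruct (Req_dec (- (d * u)) 0) as [->|]; [right; auto|].
        left. apply exp_increasing. nra. }
      pose proof (exp_pos (- (d * v))).
      replace (- (q ^ m * M / d)) with (- (q ^ m * M) * (1 / d)) by (field; lra).
      apply Rmult_le_compat_neg_l.
      + assert (0 <= q ^ m * M) by (apply Rmult_le_pos; lra). lra.
      + apply Rmult_le_compat_r; [left; apply Rinv_0_lt_compat|]; lra.
    - refine (is_RInt_le _ _ u v _ _ _ HI (RInt_correct (V := R_CompleteNormedModule) _ _ _ (Hex u v)) _);
        [lra|].
      intros t Ht. apply Hflow. lra. }
  rewrite <- (RInt_Chasles (V := R_CompleteNormedModule) (f m) 0 t0 b) by auto.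
  rewrite <- (RInt_Chasles (V := R_CompleteNormedModule) (f m) t0 t1 b) by auto.
  unfold plus; simpl.
  assert (H1 := Htail 0 t0 ltac:(lra)).
  assert (H2 := Htail t1 b ltac:(lra)).
  assert (H3 : p ^ m * eps * (t1 - t0) <= RInt (f m) t0 t1).
  { rewrite Rmult_comm.
    refine (is_RInt_le _ _ t0 t1 _ _ _ (is_RInt_const (V := R_NormedModule) t0 t1 (p ^ m * eps))
      (RInt_correct (V := R_CompleteNormedModule) _ _ _ (Hex t0 t1)) _); [lra|].
    intros t Ht. apply Hfhigh. lra. }
  lra. }
(* Let [b] tend to infinity: the integrals of [f m] tend to 0, by the vanishing kernel moments with
   [n = 0]. *)
assert (Hle0 : forall m, p ^ m * eps * (t1 - t0) - 2 * (q ^ m * M / d) <= 0).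
{ intros m.
  assert (Hlim : is_lim (fun b => RInt (f m) 0 b) p_infty 0).
  { eapply is_lim_ext; [|apply (landau_pow_integral_0 h t0 Hc Hm m 0)].
    intros b. apply RInt_ext. intros t _. unfold f. simpl.
    rewrite Rmult_0_l, Ropp_0, exp_0. ring. }
  apply (is_lim_le_loc (fun _ => p ^ m * eps * (t1 - t0) - 2 * (q ^ m * M / d))
           (fun b => RInt (f m) 0 b) p_infty
           (p ^ m * eps * (t1 - t0) - 2 * (q ^ m * M / d)) 0);
    [exists t1; intros b Hbb; apply Hint; lra|apply is_lim_const|exact Hlim]. }
assert (Hratio : 1 < p / q) by (apply Rmult_lt_reg_r with q; auto; unfold Rdiv;
  rewrite Rmult_assoc, Rinv_l by lra; lra).
(* Dividing [Hle0] by [q ^ m * (eps * (t1 - t0))] turns it into [(p / q) ^ m <= K], which fails once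
   the geometric growth reaches [K + 1]. *)
set (K := 2 * (M / d) / (eps * (t1 - t0))).
assert (HK : 0 < eps * (t1 - t0)) by (apply Rmult_lt_0_compat; lra).
destruct (Pow_x_infinity (p / q) ltac:(rewrite Rabs_pos_eq; lra) (K + 1)) as [m Hpm].
specialize (Hpm m (Nat.le_refl m)).
rewrite Rabs_pos_eq in Hpm by (apply pow_le; lra).
specialize (Hle0 m).
assert (Hqm := pow_lt q m Hq).
assert (Hp : p ^ m = (p / q) ^ m * q ^ m) by (rewrite <- Rpow_mult_distr; f_equal; field; lra).
rewrite Hp in Hle0.
assert (Hfac : q ^ m * (eps * (t1 - t0)) * ((p / q) ^ m - K) <= 0).
{ replace (q ^ m * (eps * (t1 - t0)) * ((p / q) ^ m - K))
    with ((p / q) ^ m * q ^ m * eps * (t1 - t0) - 2 * (q ^ m * M / d))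
    by (unfold K; field; repeat split; lra). exact Hle0. }
assert (0 < q ^ m * (eps * (t1 - t0)) * ((p / q) ^ m - K)); [|lra].
apply Rmult_lt_0_compat; [apply Rmult_lt_0_compat; auto|lra].
Qed.

(** The one-sided result applied to both [h] and [- h], whose moments vanish together. *)
Lemma exp_moments_0 (h : R -> R) (M d : R) : 0 < d ->
  (forall t, continuous h t) ->
  (forall t, 0 <= t -> Rabs (h t) <= M * exp (- (d * t))) ->
  (forall n : nat,
     is_lim (fun b => RInt (fun t => exp (- (INR n * t)) * h t) 0 b) p_infty 0) ->
  forall t, 0 <= t -> h t = 0.
Proof.
intros Hd Hc Hb Hm t Ht.
apply Rle_antisym; [now apply (exp_moments_0_nonpos h M d)|].
apply Ropp_le_cancel. rewrite Ropp_0.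
apply (exp_moments_0_nonpos (fun t => - h t) M d); auto.
- intros u. apply (continuous_opp (V := R_NormedModule)), Hc.
- intros u Hu. rewrite Rabs_Ropp. auto.
- intros n.
  apply is_lim_ext with (fun b => - RInt (fun t => exp (- (INR n * t)) * h t) 0 b).
  + intros b. symmetry.
    rewrite <- (RInt_opp (V := R_CompleteNormedModule) (fun t => exp (- (INR n * t)) * h t)).
    * apply RInt_ext. intros u _. unfold opp; simpl. ring.
    * apply ex_RInt_continuous_R. intros u.
      apply (continuous_mult (K := R_AbsRing)); auto using continuous_exp_scal.
  + evar_last; [apply is_lim_opp, Hm|]. simpl. f_equal. ring.
Qed.

(** * From transforms at real points to the differential equation, for real functions *)

Lemma exp_weight_bound (f : R -> R) (M a s : R) :
  (forall t, 0 <= t -> Rabs (f t) <= M * exp (a * t)) ->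
  forall t, 0 <= t -> Rabs (exp (- (s * t)) * f t) <= M * exp (- ((s - a) * t)).
Proof.
intros Hf t Ht.
rewrite Rabs_mult, (Rabs_pos_eq (exp _)) by (left; apply exp_pos).
replace (- ((s - a) * t)) with (- (s * t) + a * t) by ring. rewrite exp_plus.
rewrite <- Rmult_assoc, (Rmult_comm M), Rmult_assoc.
apply Rmult_le_compat_l; [left; apply exp_pos|auto].
Qed.

(** Removes the boundary term at infinity in the integration by parts of [ode_of_laplace]. *)
Lemma is_lim_exp_weight (f : R -> R) (M a s : R) : a < s ->
  (forall t, 0 <= t -> Rabs (f t) <= M * exp (a * t)) ->
  is_lim (fun t => exp (- (s * t)) * f t) p_infty 0.
Proof.
intros Has Hf.
assert (Hl : forall c, is_lim (fun t => c * exp (- ((s - a) * t))) p_infty 0).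
{ intros c. replace (Finite 0) with (Rbar_mult c 0) by (simpl; f_equal; ring).
  apply is_lim_scal_l, is_lim_exp_decay. lra. }
apply (is_lim_le_le_loc (fun t => - M * exp (- ((s - a) * t))) (fun t => M * exp (- ((s - a) * t))));
  [|apply Hl|apply Hl].
exists 0. intros t Ht. apply Rlt_le in Ht.
assert (Hb := exp_weight_bound f M a s Hf t Ht).
apply Rabs_le_between in Hb. lra.
Qed.

(** Meant for the real and the imaginary parts separately. The transfer relation is cross-multiplied
    because a complex quotient does not split into quotients of parts, and one part of the input
    transform may vanish. *)
Lemma ode_of_laplace (a0 a1 b0 r M a : R) (x x1 x2 y Lx Ly : R -> R) : a < r ->
  (forall t, is_derive x t (x1 t)) -> (forall t, is_derive x1 t (x2 t)) ->
  (forall t, continuous x2 t) -> (forall t, continuous y t) ->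
  x 0 = 0 -> x1 0 = 0 ->
  (forall t, 0 <= t -> Rabs (x t) <= M * exp (a * t)) ->
  (forall t, 0 <= t -> Rabs (x1 t) <= M * exp (a * t)) ->
  (forall t, 0 <= t -> Rabs (x2 t) <= M * exp (a * t)) ->
  (forall t, 0 <= t -> Rabs (y t) <= M * exp (a * t)) ->
  (forall s, r <= s -> is_lim (fun b => RInt (fun t => exp (- (s * t)) * x t) 0 b) p_infty (Lx s)) ->
  (forall s, r <= s -> is_lim (fun b => RInt (fun t => exp (- (s * t)) * y t) 0 b) p_infty (Ly s)) ->
  (forall s, r <= s -> (s ^ 2 + a1 * s + a0) * Lx s = b0 * Ly s) ->
  forall t, 0 <= t -> a0 * x t + a1 * x1 t + x2 t = b0 * y t.
Proof.
intros Har Hx Hx1 Hx2c Hyc Hx0 Hx10 Bx Bx1 Bx2 By Lxl Lyl Htf.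
set (g := fun t => a0 * x t + a1 * x1 t + x2 t - b0 * y t).
assert (Hxc : forall t, continuous x t) by (intros t; apply (ex_derive_continuous x); eexists; apply Hx).
assert (Hx1c : forall t, continuous x1 t) by (intros t; apply (ex_derive_continuous x1); eexists; apply Hx1).
assert (Hsc : forall c f, (forall t : R, continuous f t) -> forall t, continuous (fun t => c * f t) t).
{ intros c f Hf t. apply (continuous_scal_r (V := R_NormedModule) c f), Hf. }
assert (Hgc : forall t, continuous g t).
{ intros t. unfold g.
  apply (continuous_minus (V := R_NormedModule) (fun t => a0 * x t + a1 * x1 t + x2 t)); [|now apply Hsc].
  apply (continuous_plus (V := R_NormedModule) (fun t => a0 * x t + a1 * x1 t)); [|apply Hx2c].
  apply (continuous_plus (V := R_NormedModule) (fun t => a0 * x t)); now apply Hsc. }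
assert (Hew : forall s f, (forall t : R, continuous f t) ->
  forall t, continuous (fun t => exp (- (s * t)) * f t) t).
{ intros s f Hf t. apply (continuous_mult (K := R_AbsRing)); auto using continuous_exp_scal. }
assert (Bg : forall t, 0 <= t -> Rabs (g t) <= (Rabs a0 + Rabs a1 + 1 + Rabs b0) * M * exp (a * t)).
{ intros t Ht. unfold g.
  specialize (Bx t Ht). specialize (Bx1 t Ht). specialize (Bx2 t Ht). specialize (By t Ht).
  eapply Rle_trans; [apply Rabs_triang|]. rewrite Rabs_Ropp, Rabs_mult.
  pose proof (Rabs_triang (a0 * x t + a1 * x1 t) (x2 t)) as T1.
  pose proof (Rabs_triang (a0 * x t) (a1 * x1 t)) as T2.
  rewrite !Rabs_mult in T2.
  pose proof (Rmult_le_compat_l _ _ _ (Rabs_pos a0) Bx).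
  pose proof (Rmult_le_compat_l _ _ _ (Rabs_pos a1) Bx1).
  pose proof (Rmult_le_compat_l _ _ _ (Rabs_pos b0) By). lra. }
assert (Hzero : forall s, r <= s ->
  is_lim (fun b => RInt (fun t => exp (- (s * t)) * g t) 0 b) p_infty 0).
{ intros s Hs.
  apply is_lim_ext with (fun b => exp (- (s * b)) * x1 b + (s + a1) * (exp (- (s * b)) * x b)
     + (s ^ 2 + a1 * s + a0) * RInt (fun t => exp (- (s * t)) * x t) 0 b
     + (- b0) * RInt (fun t => exp (- (s * t)) * y t) 0 b).
  - intros b. symmetry.
    apply (is_RInt_unique (V := R_CompleteNormedModule)).
    (* [w'] equals [exp(-st) (G - P(s) x)], so [exp(-st) g] is
       [w' + P(s) exp(-st) x - b0 exp(-st) y]. The zero initial values give [w 0 = 0], leaving only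
       the boundary term at [b]. *)
    set (w := fun t => exp (- (s * t)) * (x1 t + (s + a1) * x t)).
    set (w' := fun t => exp (- (s * t)) * (x2 t + (s + a1) * x1 t + - s * (x1 t + (s + a1) * x t))).
    assert (Hw : is_RInt w' 0 b (minus (w b) (w 0))).
    { apply (is_RInt_derive w w').
      - intros t _. unfold w, w'. auto_derive.
        + repeat split; eexists; eauto.
        + replace (Derive (fun u => x u) t) with (x1 t) by (symmetry; apply is_derive_unique, Hx).
          replace (Derive (fun u => x1 u) t) with (x2 t) by (symmetry; apply is_derive_unique, Hx1).
          ring.
      - intros t _. apply Hew. clear t. intros t.
        apply (continuous_plus (V := R_NormedModule) (fun t => x2 t + (s + a1) * x1 t)).
        + apply (continuous_plus (V := R_NormedModule) x2); auto.
        + apply Hsc. clear t. intros t.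
          apply (continuous_plus (V := R_NormedModule) x1); auto. }
    replace (exp (- (s * b)) * x1 b + (s + a1) * (exp (- (s * b)) * x b)) with (minus (w b) (w 0)).
    2:{ change (w b - w 0 = exp (- (s * b)) * x1 b + (s + a1) * (exp (- (s * b)) * x b)).
        unfold w. rewrite Hx0, Hx10. ring. }
    apply (is_RInt_ext (V := R_NormedModule)
      (fun t => plus (plus (w' t) (scal (s ^ 2 + a1 * s + a0) (exp (- (s * t)) * x t)))
                     (scal (- b0) (exp (- (s * t)) * y t)))).
    { intros t _. unfold w', g, plus, scal; simpl; unfold mult; simpl. ring. }
    apply (is_RInt_plus (V := R_NormedModule)); [apply (is_RInt_plus (V := R_NormedModule)); [exact Hw|]|];
      apply (is_RInt_scal (V := R_NormedModule)), (RInt_correct (V := R_CompleteNormedModule)),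
        ex_RInt_continuous_R, Hew; auto.
  - assert (Hl : forall c (l : R) f, is_lim f p_infty l -> is_lim (fun b => c * f b) p_infty (c * l)).
    { intros c l f. apply is_lim_scal_l. }
    replace (Finite 0) with (Finite (0 + (s + a1) * 0 + (s ^ 2 + a1 * s + a0) * Lx s + - b0 * Ly s))
      by (f_equal; rewrite Htf by auto; ring).
    repeat apply is_lim_plus'.
    + apply (is_lim_exp_weight x1 M a); auto; lra.
    + apply Hl, (is_lim_exp_weight x M a); auto; lra.
    + apply Hl; auto.
    + apply Hl; auto. }
intros t Ht.
(* The [n]-th exponential moment of [exp(-rt) g] is the Laplace integral of [g] at [r + n], where
   [Hzero] applies; the decay rate is [r - a > 0]. *)
assert (Hh : exp (- (r * t)) * g t = 0).
{ apply (exp_moments_0 (fun t => exp (- (r * t)) * g t) ((Rabs a0 + Rabs a1 + 1 + Rabs b0) * M) (r - a)); auto.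
  - lra.
  - apply exp_weight_bound, Bg.
  - intros n. eapply is_lim_ext; [|apply (Hzero (r + INR n))].
    + intros b. apply RInt_ext. intros u _. simpl.
      rewrite <- Rmult_assoc, <- exp_plus. f_equal. f_equal. ring.
    + pose proof (pos_INR n). lra. }
apply Rmult_integral in Hh. pose proof (exp_pos (- (r * t))).
unfold g in Hh. lra.
Qed.

(** * Splitting the complex transform into real and imaginary parts *)

Lemma Cexp_real_mult (s t : R) (z : C) :
  (Cexp (- RtoC s * RtoC t) * z)%C = (exp (- (s * t)) * Re z, exp (- (s * t)) * Im z).
Proof.
destruct z as [u v]. unfold Cexp, Cmult, Copp, RtoC; simpl.
replace (- s * t - - 0 * 0) with (- (s * t)) by ring.
replace (- s * 0 + - 0 * t) with 0 by ring.
rewrite cos_0, sin_0. f_equal; ring.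
Qed.

(** [laplace] has its intended value only when the integral converges. Exponential order makes both
    component integrals converge, and their limits [l1], [l2] then identify the value. *)
Lemma is_lim_laplace_parts (f : R -> C) (M a s : R) : a < s ->
  (forall t, continuous (fun t => Re (f t)) t) ->
  (forall t, continuous (fun t => Im (f t)) t) ->
  exp_order f M a ->
  is_lim (fun b => RInt (fun t => exp (- (s * t)) * Re (f t)) 0 b) p_infty (Re (laplace f s)) /\
  is_lim (fun b => RInt (fun t => exp (- (s * t)) * Im (f t)) 0 b) p_infty (Im (laplace f s)).
Proof.
intros Has Hre Him [HM Hf].
assert (Hconv : forall u : R -> R, (forall t, continuous u t) ->
  (forall t, Rabs (u t) <= Cmod (f t)) ->
  (forall a b, ex_RInt (fun t => exp (- (s * t)) * u t) a b) /\
  exists l : R, is_lim (fun b => RInt (fun t => exp (- (s * t)) * u t) 0 b) p_infty l).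
{ intros u Hu Hb.
  assert (Hc : forall t, continuous (fun t => exp (- (s * t)) * u t) t)
    by (intros t; apply (continuous_mult (K := R_AbsRing)); auto using continuous_exp_scal).
  split; [intros; now apply ex_RInt_continuous_R|].
  apply (RInt_exp_bound_converges _ M (s - a)); [lra|exact Hc|].
  apply exp_weight_bound. intros t Ht. eapply Rle_trans; [apply Hb|auto]. }
destruct (Hconv _ Hre (fun t => Rle_trans _ _ _ (Rmax_l _ _) (Rmax_Cmod (f t)))) as [E1 [l1 L1]].
destruct (Hconv _ Him (fun t => Rle_trans _ _ _ (Rmax_r _ _) (Rmax_Cmod (f t)))) as [E2 [l2 L2]].
replace (laplace f s) with ((l1, l2) : C); [split; assumption|].
symmetry. unfold laplace.
apply (is_RInt_gen_unique (V := C_R_CompleteNormedModule)).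
set (F1 := fun t => exp (- (s * t)) * Re (f t)) in *.
set (F2 := fun t => exp (- (s * t)) * Im (f t)) in *.
apply (filterlimi_lim_ext_loc (fun ab => (RInt F1 (fst ab) (snd ab), RInt F2 (fst ab) (snd ab)))).
- apply filter_forall. intros [u v].
  apply (is_RInt_ext (V := C_R_NormedModule) (fun t => (F1 t, F2 t) : C)).
  { intros t _. symmetry. apply Cexp_real_mult. }
  apply (is_RInt_fct_extend_pair (U := R_NormedModule) (V := R_NormedModule)
    (fun t => (F1 t, F2 t)));
    apply (RInt_correct (V := R_CompleteNormedModule)); [apply E1|apply E2].
- apply (proj2 (filterlim_locally (U := C_R_NormedModule) _ _)). intros eps.
  (* The improper integral is a limit over pairs of end points; the filter at the lower end forces
     [u = 0], and the upper end carries the two limits. *)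
  apply (Filter_prod (at_point 0) (Rbar_locally p_infty) _ (fun u => u = 0)
    (fun v => ball l1 eps (RInt F1 0 v) /\ ball l2 eps (RInt F2 0 v))).
  + reflexivity.
  + apply filter_and; [exact (proj1 (filterlim_locally _ _) L1 eps)|
                       exact (proj1 (filterlim_locally _ _) L2 eps)].
  + intros u v -> Hv. exact Hv.
Qed.

Lemma is_derive_parts (f : R -> C) (t : R) : Cdifferentiable f t ->
  is_derive (fun u => Re (f u)) t (Re (Cderive f t)) /\
  is_derive (fun u => Im (f u)) t (Im (Cderive f t)).
Proof.
intros Hf. apply Cderive_correct in Hf. split.
- apply (filterdiff_comp' (V := C_R_NormedModule) (W := R_NormedModule)
           f (@fst R R) t _ (@fst R R) Hf), filterdiff_linear.
  exact (is_linear_fst (U := R_NormedModule) (V := R_NormedModule)).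
- apply (filterdiff_comp' (V := C_R_NormedModule) (W := R_NormedModule)
           f (@snd R R) t _ (@snd R R) Hf), filterdiff_linear.
  exact (is_linear_snd (U := R_NormedModule) (V := R_NormedModule)).
Qed.

Lemma exp_order_le (f : R -> C) (M M' a a' : R) : M <= M' -> a <= a' ->
  exp_order f M a -> exp_order f M' a'.
Proof.
intros HM Ha [H0 Hf]. split; [lra|]. intros t Ht.
eapply Rle_trans; [apply Hf, Ht|].
apply Rmult_le_compat; [lra|left; apply exp_pos|exact HM|].
destruct (Req_dec (a * t) (a' * t)) as [->|Hne]; [lra|].
left. apply exp_increasing. nra.
Qed.

(** * The filter equation, assembled from its two components *)

Theorem theorem2 (VI VO : R -> C) (r : C)
  (A1 : forall t : R, Cdifferentiable VI t)
  (A2 : forall t : R,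
      Cdifferentiable VO t /\
      Cdifferentiable (Cderive VO) t /\
      Cdifferentiable (Cderive (Cderive VO)) t)
  (A3 : VO 0 = RtoC 0 /\ Cderive VO 0 = RtoC 0)
  (A4 : forall s : C, Re r <= Re s ->
      (s ^ 2 + sk_a1 * s + sk_a0)%C <> RtoC 0)
  (A5 : forall s : C, Re r <= Re s -> laplace VI s <> RtoC 0)
  (A6 : 0 < Re r)
  (A7 : forall s : C, Re r <= Re s -> laplace_exists VI s)
  (A8 : forall s : C, Re r <= Re s ->
      laplace_exists VO s /\
      laplace_exists (Cderive VO) s /\
      laplace_exists (Cderive (Cderive VO)) s)
  (A9 : forall s : C, Re r <= Re s ->
      (laplace VO s / laplace VI s)%C =
      (sk_b0 / (s ^ 2 + sk_a1 * s + sk_a0))%C) :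
  forall t : R, 0 <= t ->
    (sk_a0 * VO t + sk_a1 * Cderive VO t + Cderive (Cderive VO) t)%C =
    (sk_b0 * VI t)%C.
Proof.
(* The growth bounds are taken at [s = r] and merged by maxima; the resulting [a < Re r] then serves
   every real [s >= Re r]. *)
assert (Hord : exists M a, a < Re r /\ exp_order VI M a /\ exp_order VO M a /\
  exp_order (Cderive VO) M a /\ exp_order (Cderive (Cderive VO)) M a).
{ destruct (A7 r (Rle_refl _)) as [_ [M0 [e0 [He0 H0]]]].
  destruct (A8 r (Rle_refl _)) as [[_ [M1 [e1 [He1 H1]]]]
    [[_ [M2 [e2 [He2 H2]]]] [_ [M3 [e3 [He3 H3]]]]]].
  exists (Rmax (Rmax M0 M1) (Rmax M2 M3)), (Rmax (Rmax e0 e1) (Rmax e2 e3)).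
  split; [repeat apply Rmax_lub_lt; assumption|].
  split; [|split; [|split]];
    [apply (exp_order_le VI M0 _ e0)|apply (exp_order_le VO M1 _ e1)|
     apply (exp_order_le (Cderive VO) M2 _ e2)|apply (exp_order_le _ M3 _ e3)]; trivial;
    eauto using Rle_trans, Rmax_l, Rmax_r. }
destruct Hord as [M [a [Har [OI [O0 [O1 O2]]]]]].
destruct A3 as [V0 V0'].
assert (Hcont : forall f : R -> C, (forall t, Cdifferentiable f t) ->
  (forall t, continuous (fun t => Re (f t)) t) /\ (forall t, continuous (fun t => Im (f t)) t)).
{ intros f Hf; split; intros t.
  - apply (ex_derive_continuous (fun t => Re (f t))).
    exists (Re (Cderive f t)). apply (is_derive_parts f t (Hf t)).
  - apply (ex_derive_continuous (fun t => Im (f t))).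
    exists (Im (Cderive f t)). apply (is_derive_parts f t (Hf t)). }
assert (HbRe : forall f, exp_order f M a -> forall t, 0 <= t -> Rabs (Re (f t)) <= M * exp (a * t)).
{ intros f [_ Hf] t Ht. eapply Rle_trans; [|apply Hf, Ht].
  exact (Rle_trans _ _ _ (Rmax_l _ _) (Rmax_Cmod (f t))). }
assert (HbIm : forall f, exp_order f M a -> forall t, 0 <= t -> Rabs (Im (f t)) <= M * exp (a * t)).
{ intros f [_ Hf] t Ht. eapply Rle_trans; [|apply Hf, Ht].
  exact (Rle_trans _ _ _ (Rmax_r _ _) (Rmax_Cmod (f t))). }
assert (D0 : forall t, Cdifferentiable VO t) by (intros t; apply (A2 t)).
assert (D1 : forall t, Cdifferentiable (Cderive VO) t) by (intros t; apply (A2 t)).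
assert (D2 : forall t, Cdifferentiable (Cderive (Cderive VO)) t) by (intros t; apply (A2 t)).
destruct (Hcont _ D0) as [C0 C0']. destruct (Hcont _ D2) as [C2 C2'].
destruct (Hcont _ A1) as [CI CI'].
(* Clearing denominators in [A9]: [A5] permits multiplying back by the input transform, [A4] by the
   polynomial. *)
assert (Htf : forall s : R, Re r <= s ->
  (RtoC (s ^ 2 + sk_a1 * s + sk_a0) * laplace VO s = RtoC sk_b0 * laplace VI s)%C).
{ intros s Hs.
  assert (Hs' : Re r <= Re (RtoC s)) by exact Hs.
  assert (E := A9 _ Hs'). assert (N := A4 _ Hs'). assert (NI := A5 _ Hs').
  replace (RtoC (s ^ 2 + sk_a1 * s + sk_a0)) with (RtoC s ^ 2 + sk_a1 * s + sk_a0)%C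
    by (rewrite !RtoC_plus, RtoC_mult, RtoC_pow; reflexivity).
  replace (laplace VO s) with (laplace VO s / laplace VI s * laplace VI s)%C by (field; exact NI).
  rewrite E. field. exact N. }
(* For real [s] the polynomial and [sk_b0] are real scalars, so the relation holds for each part
   separately. *)
assert (HtfRe : forall s, Re r <= s ->
  (s ^ 2 + sk_a1 * s + sk_a0) * Re (laplace VO s) = sk_b0 * Re (laplace VI s)).
{ intros s Hs. assert (E := f_equal Re (Htf s Hs)).
  destruct (laplace VO s), (laplace VI s). unfold Re, Cmult, RtoC in *; simpl fst in *. lra. }
assert (HtfIm : forall s, Re r <= s ->
  (s ^ 2 + sk_a1 * s + sk_a0) * Im (laplace VO s) = sk_b0 * Im (laplace VI s)).
{ intros s Hs. assert (E := f_equal Im (Htf s Hs)).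
  destruct (laplace VO s), (laplace VI s). unfold Im, Cmult, RtoC in *; simpl snd in *. lra. }
assert (HRe := ode_of_laplace sk_a0 sk_a1 sk_b0 (Re r) M a
  (fun t => Re (VO t)) (fun t => Re (Cderive VO t)) (fun t => Re (Cderive (Cderive VO) t))
  (fun t => Re (VI t)) (fun s => Re (laplace VO s)) (fun s => Re (laplace VI s)) Har
  (fun t => proj1 (is_derive_parts _ t (D0 t))) (fun t => proj1 (is_derive_parts _ t (D1 t)))
  C2 CI (f_equal Re V0) (f_equal Re V0') (HbRe _ O0) (HbRe _ O1) (HbRe _ O2) (HbRe _ OI)
  (fun s Hs => proj1 (is_lim_laplace_parts VO M a s (Rlt_le_trans _ _ _ Har Hs) C0 C0' O0))
  (fun s Hs => proj1 (is_lim_laplace_parts VI M a s (Rlt_le_trans _ _ _ Har Hs) CI CI' OI))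
  HtfRe).
assert (HIm := ode_of_laplace sk_a0 sk_a1 sk_b0 (Re r) M a
  (fun t => Im (VO t)) (fun t => Im (Cderive VO t)) (fun t => Im (Cderive (Cderive VO) t))
  (fun t => Im (VI t)) (fun s => Im (laplace VO s)) (fun s => Im (laplace VI s)) Har
  (fun t => proj2 (is_derive_parts _ t (D0 t))) (fun t => proj2 (is_derive_parts _ t (D1 t)))
  C2' CI' (f_equal Im V0) (f_equal Im V0') (HbIm _ O0) (HbIm _ O1) (HbIm _ O2) (HbIm _ OI)
  (fun s Hs => proj2 (is_lim_laplace_parts VO M a s (Rlt_le_trans _ _ _ Har Hs) C0 C0' O0))
  (fun s Hs => proj2 (is_lim_laplace_parts VI M a s (Rlt_le_trans _ _ _ Har Hs) CI CI' OI))
  HtfIm).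
intros t Ht. specialize (HRe t Ht). specialize (HIm t Ht). cbv beta in HRe, HIm.
destruct (VO t), (Cderive VO t), (Cderive (Cderive VO) t), (VI t).
unfold Re, Im, Cmult, Cplus, RtoC in *; simpl fst in *; simpl snd in *.
f_equal; lra.
Qed.
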